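(* Let $\Bbbk$ be a field of characteristic zero and let $n\ge 1$ be an integer. Then the artinian algebra $A(T_{4,n})$ has the weak Lefschetz property if and only if $n\in\{1,2,3,4,5,6,7,9,10,13\}$.
   Context: For integers $m\ge 3$, $n\ge 1$, the tadpole graph $T_{m,n}$ is the simple graph with vertex set $\{x_1,\dots,x_m,y_1,\dots,y_n\}$ and edges $\{x_i,x_{i+1}\}$ for $1\le i\le m-1$, $\{x_m,x_1\}$ (so the $x_i$ form an $m$-cycle), $\{y_j,y_{j+1}\}$ for $1\le j\le n-1$ (so the $y_j$ form a path), and the bridge $\{x_m,y_1\}$. For a simple graph $G$ on vertices $1,\dots,N$, let $R=\Bbbk[x_1,\dots,x_N]$ be the standard graded polynomial ring, $I(G)=(x_ix_j : \{i,j\}\text{ an edge of }G)$ its edge ideal, and $A(G)=R/\big((x_1^2,\dots,x_N^2)+I(G)\big)$, a standard graded artinian algebra $A=\bigoplus_{j=0}^s [A]_j$. Such an $A$ has the weak Lefschetz property (WLP) if there is a linear form $\ell\in[A]_1$ such that multiplication $\times\ell:[A]_j\to[A]_{j+1}$ is injective or surjective for every $j=0,\dots,s-1$. *)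

(* Defs.v *)
From mathcomp Require Import all_boot all_order all_algebra.
From mathcomp Require Import mpoly.
Set Implicit Arguments.
Unset Strict Implicit.
Unset Printing Implicit Defensive.
Import GRing.Theory.
Local Open Scope ring_scope.

(* Tadpole graph T_{m,n} on 'I_(m+n):  x_i  |-> i-1  (0 <= i-1 < m),
   y_j |-> m + j - 1.  Edges: consecutive pairs {v, v+1} for v+1 < m+n
   (this gives the path x_1..x_m, the bridge {x_m,y_1} and the path
   y_1..y_n), plus the closing edge {x_m, x_1} = {m-1, 0}. *)
Definition tadpole_edge (m n : nat) : rel 'I_(m + n) :=
  fun i j =>
    [|| (val j == (val i).+1)%N, (val i == (val j).+1)%N,
        (val i == 0)%N && (val j == m.-1)%N
      | (val j == 0)%N && (val i == m.-1)%N].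

Arguments tadpole_edge : clear implicits.

Section EdgeIdeal.
Variables (k : fieldType) (N : nat) (E : rel 'I_N).

Definition in_J (p : {mpoly k[N]}) : Prop :=
  exists (c : 'I_N -> {mpoly k[N]}) (d : 'I_N -> 'I_N -> {mpoly k[N]}),
    p = \sum_(i < N) c i * 'X_i ^+ 2
        + \sum_(i < N) \sum_(j < N | E i j) d i j * ('X_i * 'X_j).

(* A(G) = R/J is graded; [A]_j = [R]_j / [J]_j (J is a homogeneous ideal).
   For a linear form l (a representative in [R]_1 of an element of [A]_1),
   the map  x l : [A]_j -> [A]_(j+1)  is: *)
Definition mult_injective (l : {mpoly k[N]}) (j : nat) : Prop :=
  forall f : {mpoly k[N]}, f \is j.-homog -> in_J (l * f) -> in_J f.

Definition mult_surjective (l : {mpoly k[N]}) (j : nat) : Prop :=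
  forall g : {mpoly k[N]}, g \is j.+1.-homog ->
    exists2 f : {mpoly k[N]}, f \is j.-homog & in_J (g - l * f).

(* Weak Lefschetz property of A(G).  We quantify over all j >= 0: for
   j >= s (the socle degree) [A]_(j+1) = 0, so the map is trivially
   surjective there, and the condition is the same as for 0 <= j <= s-1. *)
Definition WLP : Prop :=
  exists2 l : {mpoly k[N]}, l \is 1.-homog &
    forall j : nat, mult_injective l j \/ mult_surjective l j.

End EdgeIdeal.

(* Main.v *)
Require Import Defs.
From mathcomp Require Import all_boot all_order all_algebra.
From mathcomp Require Import mpoly.
From mathcomp Require Import zify ring.
Set Implicit Arguments.
Unset Strict Implicit.
Unset Printing Implicit Defensive.
Import GRing.Theory.
Local Open Scope ring_scope.

(* A(G) has the independent sets of G as a basis, and multiplication by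
   [\sum_v a v * X_v] sends a function [f] on these sets to
   [S |-> \sum_(v in S) a v * f (S :\ v)].

   Failure, for an arbitrary linear form l.  Cut the vertices, in their given
   order, into blocks of four; in each block some nonzero linear form is
   annihilated by the part of l living there, and the product over the blocks is
   a nonzero element of degree ceil((n+4)/4) killed by l.  Dually, pairs of
   adjacent vertices separated by one vertex (the multiples of 3) carry linear
   functionals vanishing on l, and their product shows that l is not onto degree
   j+1 as soon as 3j <= n+1.  For n = 8, 11, 12 and n >= 14 both happen in the
   same degree.

   WLP, with l the sum of the variables.  On the path with q vertices, l^p is
   injective in degree j if 4j + 2(p-1) < q, and onto degree i if
   3i - (p-1) >= q+2.  Allowing all powers of l is what makes an induction on the
   path possible: by the Leibniz rule, splitting off an end vertex turns a
   condition on l^p into conditions on l^(p+1) and l^(p-1) on shorter paths.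
   Eliminating the vertices of the 4-cycle then only involves powers up to 3. *)

(** * The quotient algebra in the basis of independent sets *)

Section Translation.
Variables (k : fieldType) (N : nat) (E : rel 'I_N).
Hypothesis E_irr : irreflexive E.
Implicit Types (S T : {set 'I_N}) (p q : {mpoly k[N]}).

Definition indep S := [forall v in S, forall w in S, ~~ E v w].

Lemma indepP S : reflect {in S &, forall v w, ~~ E v w} (indep S).
Proof.
apply: (iffP forall_inP) => [h v w vS wS|h v vS].
  by move/forall_inP: (h v vS); apply.
by apply/forall_inP => w wS; apply: h.
Qed.

Lemma indepS S T : T \subset S -> indep S -> indep T.
Proof.
move=> /subsetP sTS /indepP h; apply/indepP => v w vT wT.
by apply: h; apply: sTS.
Qed.

Definition up (a : 'I_N -> k) (f : {set 'I_N} -> k) : {set 'I_N} -> k :=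
  fun S => \sum_(v in S) a v * f (S :\ v).

Lemma mcoeffMX_if p (m n : 'X_{1..N}) :
  (p * 'X_[m])@_n = if (m <= n)%MM then p@_(n - m) else 0.
Proof.
case: ifP => [le_mn|/negP nle_mn].
  by rewrite -{1}(submK le_mn) addmC mcoeffMX.
apply/eqP; rewrite mcoeff_eq0; apply/negP => /msuppM_le /allpairsP.
case=> -[m1 m2] /= [_]; rewrite msuppX inE => /eqP -> def_n.
by apply: nle_mn; rewrite def_n; apply: lem_addl.
Qed.

Lemma in_J_add p q : in_J E p -> in_J E q -> in_J E (p + q).
Proof.
move=> [c [d ->]] [c' [d' ->]].
exists (fun i => c i + c' i), (fun i j => d i j + d' i j).
rewrite addrACA; congr (_ + _); rewrite -big_split; apply: eq_bigr => i _.
  by rewrite mulrDl.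
by rewrite -big_split; apply: eq_bigr => j _; rewrite mulrDl.
Qed.

Lemma in_J0 : in_J E (0 : {mpoly k[N]}).
Proof.
exists (fun=> 0), (fun _ _ => 0).
rewrite !big1 ?addr0 // => i _; last by rewrite mul0r.
by rewrite big1 // => j _; rewrite mul0r.
Qed.

Lemma in_J_square p i : in_J E (p * 'X_i ^+ 2).
Proof.
exists (fun j => if j == i then p else 0), (fun _ _ => 0).
rewrite (bigD1 i) //= eqxx !big1 ?addr0 // => j.
  by rewrite big1 // => l _; rewrite mul0r.
by move/negPf=> ->; rewrite mul0r.
Qed.

Lemma in_J_edge p i j : E i j -> in_J E (p * ('X_i * 'X_j)).
Proof.
move=> Eij.
exists (fun=> 0), (fun u v => if (u == i) && (v == j) then p else 0).
rewrite [X in X + _]big1 ?add0r => [|u _]; last by rewrite mul0r.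
rewrite (bigD1 i) //= (bigD1 j) //= !eqxx !big1 ?addr0 //=.
  by move=> u /negPf ui; rewrite big1 // => v _; rewrite ui mul0r.
by move=> v /andP[_ /negPf ->]; rewrite mul0r.
Qed.

(** The ideal is generated by monomials, so membership is tested monomial by monomial; a monomial
    escapes it exactly when it is squarefree with independent support. *)
Lemma in_JP p : in_J E p <-> (forall S, indep S -> p@_(mesym1 S) = 0).
Proof.
split=> [[c [d ->]] S /indepP iS|h].
  rewrite mcoeffD !raddf_sum /= !big1 ?addr0 // => i _.
    rewrite raddf_sum big1 //= => j Eij.
    rewrite -mpolyXD mcoeffMX_if; case: ifP => // /mnm_lepP le.
    have := le i; have := le j; rewrite !mnmDE !mnm1E !mnmE !eqxx.
    have iS' : i \in S -> j \in S -> False by move=> /iS h /h; rewrite Eij.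
    by move: iS'; case: (i \in S); case: (j \in S) => //= [/(_ isT isT)|] //; lia.
  rewrite mpolyXn mcoeffMX_if; case: ifP => // /mnm_lepP /(_ i).
  by rewrite mulmnE mnm1E mnmE eqxx; case: (i \in S).
rewrite [p]mpolyE; elim/big_ind: _ => [||m _]; [exact: in_J0|exact: in_J_add|].
case: (boolP [exists i, 1 < m i]%N) => [/existsP[i mi]|/existsPn m1].
  have le : (U_(i) *+ 2 <= m)%MM.
    apply/mnm_lepP => j; rewrite mulmnE mnm1E; case: eqP => [<-|] //; lia.
  by rewrite -(submK le) mpolyXD -mpolyXn scalerAl; apply: in_J_square.
pose S := [set i | m i != 0%N].
have def_m : m = mesym1 S.
  by apply/mnmP => i; rewrite mnmE inE; have := m1 i; case: (m i) => [|[]].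
case: (boolP (indep S)) => [iS|]; first by rewrite {1}def_m h // scale0r; apply: in_J0.
rewrite negb_forall_in => /exists_inP[i iS].
rewrite negb_forall_in => /exists_inP[j jS]; rewrite negbK => Eij.
case: (eqVneq i j) => [ij|/negPf ij]; first by rewrite ij E_irr in Eij.
have le : (U_(i) + U_(j) <= m)%MM.
  apply/mnm_lepP => l; rewrite mnmDE !mnm1E; move: iS jS; rewrite !inE.
  case: (eqVneq i l) => [<-|]; first by rewrite [j == i]eq_sym ij; lia.
  by case: (eqVneq j l) => [<-|]; lia.
by rewrite -(submK le) !mpolyXD scalerAl; apply: in_J_edge.
Qed.

Lemma mcoeff_homogM (l f : {mpoly k[N]}) S : l \is 1.-homog ->
  (l * f)@_(mesym1 S) = up (fun v => l@_U_(v)) (fun T => f@_(mesym1 T)) S.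
Proof.
move=> l1.
have {1}-> : l = \sum_(v < N) l@_U_(v) *: 'X_v.
  apply/mpolyP => m; rewrite raddf_sum /=.
  case: (boolP (mdeg m == 1%N)) => [/mdeg1P[v /eqP ->]|m1].
    rewrite (bigD1 v) //= mcoeffZ mcoeffXU eqxx mulr1 big1 ?addr0 // => w /negPf wv.
    by rewrite mcoeffZ mcoeffXU wv mulr0.
  rewrite (dhomog_nemf_coeff l1 m1) big1 // => v _; rewrite mcoeffZ mcoeffX.
  by case: (U_(v)%MM =P m) m1 => [<-|]; rewrite ?mdeg1 ?mulr0.
rewrite mulr_suml raddf_sum /= [RHS]big_mkcond; apply: eq_bigr => v _.
rewrite -scalerAl mcoeffZ [_ * f]mulrC mcoeffMX_if lep1mP mnmE.
case: (boolP (v \in S)) => vS; rewrite ?mulr0 //=; congr (_ * f@__).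
apply/mnmP => w; rewrite mnmBE mnm1E !mnmE !inE [w == v]eq_sym.
by case: eqP => [<-|_]; rewrite ?vS ?subn0.
Qed.

Definition poly_of j (g : {set 'I_N} -> k) : {mpoly k[N]} :=
  \sum_(S : {set 'I_N} | #|S| == j) g S *: 'X_[mesym1 S].

Lemma mesym1_inj : injective (@mesym1 N).
Proof.
move=> S T /mnmP eST; apply/setP => v; have := eST v; rewrite !mnmE.
by case: (v \in S); case: (v \in T).
Qed.

Lemma poly_of_homog j g : poly_of j g \is j.-homog.
Proof.
apply: rpred_sum => S /eqP cS; apply: rpredZ.
by rewrite dhomogX /= mdeg_mesym1 cS.
Qed.

Lemma mcoeff_poly_of j g S :
  (poly_of j g)@_(mesym1 S) = if #|S| == j then g S else 0.
Proof.
rewrite raddf_sum /=.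
have coefE T : (g T *: 'X_[mesym1 T])@_(mesym1 S) = if T == S then g S else 0.
  rewrite mcoeffZ mcoeffX (inj_eq mesym1_inj).
  by case: eqP => [->|_]; rewrite ?mulr1 ?mulr0.
under eq_bigr do rewrite coefE.
rewrite -big_mkcondr big_mkcond (bigD1 S) //= eqxx andbT big1 ?addr0 // => T /negPf ->.
by rewrite andbF.
Qed.

(** Arbitrary functions on sets can replace homogeneous polynomials, since both sides only read
    values on independent sets of size [j]. *)
Lemma mult_injectiveP (l : {mpoly k[N]}) j : l \is 1.-homog ->
  mult_injective E l j <->
  (forall f : {set 'I_N} -> k,
    (forall S, indep S -> #|S| = j.+1 -> up (fun v => l@_U_(v)) f S = 0) ->
    forall S, indep S -> #|S| = j -> f S = 0).
Proof.
move=> l1; split=> [inj f f0 S iS cS|inj f fj /in_JP f0].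
  have := inj (poly_of j f) (poly_of_homog j f).
  rewrite !in_JP => /(_ _ S iS); rewrite mcoeff_poly_of cS eqxx; apply => T iT.
  rewrite mcoeff_homogM //; case: (eqVneq #|T| j.+1) => cT.
    rewrite -[RHS](f0 _ iT cT); apply: eq_bigr => v vT.
    by rewrite mcoeff_poly_of; move: cT; rewrite (cardsD1 v) vT add1n => -[->]; rewrite eqxx.
  apply: big1 => v vT; rewrite mcoeff_poly_of.
  by move: cT; rewrite (cardsD1 v) vT add1n eqSS => /negPf ->; rewrite mulr0.
apply/in_JP => S iS; case: (eqVneq #|S| j) => cS; last first.
  by rewrite (dhomog_nemf_coeff fj) //= mdeg_mesym1.
apply: (inj (fun S => f@_(mesym1 S))) => // T iT _.
by rewrite -mcoeff_homogM // f0.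
Qed.

Lemma mult_surjectiveP (l : {mpoly k[N]}) j : l \is 1.-homog ->
  mult_surjective E l j <->
  (forall g : {set 'I_N} -> k, exists f : {set 'I_N} -> k,
    forall S, indep S -> #|S| = j.+1 -> up (fun v => l@_U_(v)) f S = g S).
Proof.
move=> l1; split=> surj g => [|gj].
  have [f _ /in_JP f0] := surj _ (poly_of_homog j.+1 g).
  exists (fun T => f@_(mesym1 T)) => S iS cS; apply/esym/eqP.
  rewrite -subr_eq0 -mcoeff_homogM //; apply/eqP.
  by move: (f0 S iS); rewrite mcoeffB mcoeff_poly_of cS eqxx.
have [f ef] := surj (fun T => g@_(mesym1 T)).
exists (poly_of j f); first exact: poly_of_homog.
apply/in_JP => S iS; rewrite mcoeffB mcoeff_homogM //.
case: (eqVneq #|S| j.+1) => cS.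
  rewrite -(ef S iS cS) -sumrB big1 // => v vS; rewrite mcoeff_poly_of.
  by move: cS; rewrite (cardsD1 v) vS add1n => -[->]; rewrite eqxx subrr.
rewrite (dhomog_nemf_coeff gj) /= ?mdeg_mesym1 // [X in _ - X]big1 ?subr0 // => v vS.
by move: cS; rewrite mcoeff_poly_of (cardsD1 v) vS add1n eqSS => /negPf ->; rewrite mulr0.
Qed.
End Translation.

(** * Products of linear forms over disjoint blocks of vertices *)

Section Transversals.
Variables (k : fieldType) (N D : nat) (E : rel 'I_N).
Variables (a c : 'I_N -> k) (blk : 'I_N -> 'I_D) (s : 'I_D -> 'I_N).
Hypothesis blk_s : cancel s blk.
Hypothesis c_s : forall b, c (s b) != 0.
Implicit Types S T : {set 'I_N}.

(** These sets choose one vertex in each of the [D] blocks; they index the monomials of a product of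
    one linear form per block. *)
Definition transversal S := (#|S| == D) && (blk @: S == setT).

Lemma transversal_rep : transversal (s @: setT).
Proof.
rewrite /transversal card_imset ?cardsT ?card_ord ?eqxx; last exact: can_inj blk_s.
rewrite -imset_comp; apply/eqP/setP => b; rewrite inE.
by apply/imsetP; exists b; rewrite ?inE //= blk_s.
Qed.

Lemma transversal_inj S : transversal S -> {in S &, injective blk}.
Proof.
by case/andP=> /eqP cS /eqP bS; apply/imset_injP; rewrite bS cS cardsT card_ord.
Qed.

Lemma prod_rep_neq0 : \prod_(v in s @: setT) c v != 0.
Proof. by rewrite prodf_seq_neq0; apply/allP => v _; apply/implyP => /imsetP[b _ ->]. Qed.

(* The product over the blocks of the linear forms [\sum_(v in block) c v * X_v]
   is annihilated by [\sum_v a v * X_v]. *)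
Lemma up_not_injective :
  (forall b b', ~~ E (s b) (s b')) ->
  (forall v w, v != w -> blk v = blk w -> ~~ E v w -> a v * c w + a w * c v = 0) ->
  ~ (forall f : {set 'I_N} -> k,
      (forall S, indep E S -> #|S| = D.+1 -> up a f S = 0) ->
      forall S, indep E S -> #|S| = D -> f S = 0).
Proof.
move=> s_indep ac0 inj.
pose f S := if transversal S then \prod_(v in S) c v else 0.
have: f (s @: setT) != 0 by rewrite /f transversal_rep prod_rep_neq0.
move/eqP; apply; apply: inj; last 2 first.
- by apply/indepP => _ _ /imsetP[b _ ->] /imsetP[b' _ ->].
- by case/andP: transversal_rep => /eqP.
move=> S iS cS.
(* Pigeonhole: two elements [v], [w] of [S] share a block. Only removing one of these two can leave
   a transversal, and the two resulting terms cancel by [ac0]. *)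
have: ~~ dinjectiveb blk (mem S).
  apply/dinjectiveP => /imset_injP; rewrite cS => /eqP cD.
  by have := max_card (mem (blk @: S)); rewrite cD card_ord ltnn.
case/dinjectivePn => v vS [w]; rewrite !inE => /andP[wv wS] bvw.
have img x y : x \in S -> y \in S -> x != y -> blk x = blk y -> blk @: (S :\ x) = blk @: S.
  move=> xS yS xy bxy; apply/eqP; rewrite eqEsubset imsetS ?subsetDl //=.
  apply/subsetP => _ /imsetP[z zS ->]; apply/imsetP.
  case: (eqVneq z x) => [->|zx]; first by exists y; rewrite // !inE eq_sym xy.
  by exists z; rewrite // !inE zx.
have card x : x \in S -> #|S :\ x| = D.
  by move=> xS; move: cS; rewrite (cardsD1 x) xS add1n => -[].
rewrite /up (bigD1 v) //= (bigD1 w) /=; last by rewrite wS.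
rewrite big1 => [|u /andP[/andP[uS uv] uw]]; last first.
  rewrite /f; case: ifP => [/transversal_inj inju|_]; last by rewrite mulr0.
  have vw : v = w by apply: inju; rewrite // !inE eq_sym ?uv ?uw.
  by rewrite vw eqxx in wv.
have vw : v != w by rewrite eq_sym.
have -> : f (S :\ v) = if blk @: S == setT then c w * \prod_(u in S :\ v :\ w) c u else 0.
  rewrite /f /transversal card // (img v w) // eqxx /=; case: ifP => // _.
  by rewrite (big_setD1 w) // !inE wv.
have -> : f (S :\ w) = if blk @: S == setT then c v * \prod_(u in S :\ v :\ w) c u else 0.
  rewrite /f /transversal card // (img w v) // eqxx /=; case: ifP => // _.
  by rewrite (big_setD1 v) ?inE ?vw //= setDDl setUC -setDDl.
case: ifP => _; last by rewrite !mulr0 !addr0.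
rewrite addr0 !mulrA -mulrDl ac0 ?mul0r //.
by move/indepP: iS; apply.
Qed.

(* The functional pairing [h] with the product over the blocks of the linear forms
   [\sum_(v in block) c v * X_v] kills the image of [up a], but not every [h]. *)
Lemma up_not_surjective :
  (forall v w, E v w -> c v != 0 -> c w != 0 -> blk v = blk w) ->
  (irreflexive E) ->
  (forall b, \sum_(v | blk v == b) a v * c v = 0) ->
  ~ (forall g : {set 'I_N} -> k, exists f : {set 'I_N} -> k,
      forall S, indep E S -> #|S| = D -> up a f S = g S).
Proof.
move=> cE E_irr ac0 surj.
(* Pairing the coefficients with this indicator gives the nonzero product over the representatives,
   whereas pairing them with [up a f] gives zero. *)
have [f ef] := surj (fun S => (S == s @: setT)%:R).
have /eqP := prod_rep_neq0; apply.
transitivity (\sum_(S : {set 'I_N} | transversal S)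
    (\prod_(v in S) c v) * (S == s @: setT)%:R).
  rewrite [RHS](bigD1 (s @: setT)) ?transversal_rep //= eqxx mulr1 [X in _ + X]big1 ?addr0 //.
  by move=> S /andP[_ /negPf ->]; rewrite mulr0.
transitivity (\sum_(S : {set 'I_N} | transversal S) (\prod_(v in S) c v) * up a f S).
  apply: eq_bigr => S tS; case: (boolP (indep E S)) => [iS|].
    by rewrite ef //; case/andP: tS => /eqP.
  rewrite negb_forall_in => /exists_inP[v vS].
  rewrite negb_forall_in => /exists_inP[w wS]; rewrite negbK => Evw.
  have vw : v != w by apply: contraTneq Evw => ->; rewrite E_irr.
  (* On a dependent [S] nothing is known of [up a f S], but the weight is zero: by [cE], adjacent
     vertices with nonzero coefficients lie in one block. *)
  suff -> : \prod_(v in S) c v = 0 by rewrite !mul0r.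
  have wSv : w \in S :\ v by rewrite !inE eq_sym vw.
  apply/eqP; rewrite (big_setD1 v) // (big_setD1 w) //= !mulf_eq0.
  apply: contraTT vw; rewrite !negb_or negbK => /andP[cv /andP[cw _]].
  by apply/eqP/(transversal_inj tS) => //; apply: cE.
under eq_bigr do rewrite mulr_sumr.
rewrite pair_big_dep /=.
(* Regroup the pairs [(S, v)] by [T = S :\ v]. Such a [T] misses exactly one block and [v] runs
   through all of it, so the inner sum is a multiple of the one in [ac0]. *)
rewrite (reindex_onto (fun p => (p.2 |: p.1, p.2)) (fun p => (p.1 :\ p.2, p.2))) /=;
  last first.
  by case=> S v /= /andP[_ vS]; rewrite setD1K.
rewrite (eq_bigl (fun p : {set 'I_N} * 'I_N =>
  (p.2 \notin p.1) && transversal (p.2 |: p.1))); last first.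
  case=> T v /=; rewrite !inE eqxx /= andbT xpair_eqE eqxx andbT andbC.
  congr (_ && _); apply/eqP/idP => [<-|vT]; first by rewrite !inE eqxx.
  by rewrite setU1K.
rewrite -(pair_big_dep xpredT (fun T v => (v \notin T) && transversal (v |: T))
  (fun T v => (\prod_(u in v |: T) c u) * (a v * f ((v |: T) :\ v)))) /=.
apply: big1 => T _.
case: (boolP [exists v, (v \notin T) && transversal (v |: T)]) => [|/existsPn no]; last first.
  by apply: big1 => v; rewrite (negPf (no v)).
case/existsP => v0 /andP[v0T tv0].
have cT : #|T|.+1 = D by case/andP: tv0 => /eqP; rewrite cardsU1 v0T.
have nb0 : blk v0 \notin blk @: T.
  apply/imsetP => -[w wT bw]; move: v0T.
  by rewrite (transversal_inj tv0 _ _ bw) ?wT // !inE ?eqxx ?wT ?orbT.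
rewrite (eq_bigl (fun v => blk v == blk v0)) => [|v]; last first.
  apply/andP/eqP => [[vT tv]|bv].
    have : blk v0 \in blk @: (v |: T) by case/andP: tv => _ /eqP ->; rewrite inE.
    by rewrite imsetU1 !inE (negPf nb0) orbF => /eqP.
  have vT : v \notin T by apply: contra nb0; rewrite -bv; apply: imset_f.
  split=> //; rewrite /transversal cardsU1 vT add1n cT eqxx /=.
  by rewrite imsetU1 bv -imsetU1; case/andP: tv0.
transitivity (\sum_(v | blk v == blk v0) (\prod_(u in T) c u) * f T * (a v * c v)).
  apply: eq_bigr => v /eqP bv.
  have vT : v \notin T by apply: contra nb0; rewrite -bv; apply: imset_f.
  by rewrite big_setU1 //= setU1K //; ring.
by rewrite -mulr_sumr ac0 mulr0.
Qed.
End Transversals.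

(** * Obstructions to injectivity and surjectivity on the tadpole *)

Lemma tadpole_edge_irr m n : (2 < m)%N -> irreflexive (tadpole_edge m n).
Proof. by move=> m2 v; apply/negbTE; rewrite /tadpole_edge; lia. Qed.

Section Failure.
Variables (k : fieldType) (n : nat) (a : 'I_(4 + n) -> k).

(** Extension by zero lets the formulas for a full block serve a truncated last block. *)
Let A i : k := if (i < 4 + n)%N then a (inord i) else 0.

Let AE (v : 'I_(4 + n)) : a v = A v.
Proof. by rewrite /A ltn_ord; congr a; apply: val_inj; rewrite /= inordK. Qed.

Let A_neq0 i : A i != 0 -> (i < 4 + n)%N.
Proof. by rewrite /A; case: ifP; rewrite ?eqxx. Qed.

(** The possible non-edges inside a block are at positions 0-2, 0-3 and 1-3; in the first block 0-3
    is the closing edge of the cycle, whence the condition [0 < b]. *)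
Let block4_pairs b (c0 c1 c2 c3 : k) :
  ((4 * b + 2 < 4 + n)%N -> A (4 * b) * c2 + A (4 * b + 2) * c0 = 0) ->
  ((4 * b + 3 < 4 + n)%N -> (0 < b)%N -> A (4 * b) * c3 + A (4 * b + 3) * c0 = 0) ->
  ((4 * b + 3 < 4 + n)%N -> A (4 * b + 1) * c3 + A (4 * b + 3) * c1 = 0) ->
  forall v w : 'I_(4 + n), v != w -> (v %/ 4)%N = b -> (w %/ 4)%N = b ->
  ~~ tadpole_edge 4 n v w ->
  a v * [:: c0; c1; c2; c3]`_(w %% 4)%N + a w * [:: c0; c1; c2; c3]`_(v %% 4)%N = 0.
Proof.
move=> h02 h03 h13.
have main (v w : 'I_(4 + n)) : (v < w)%N -> (v %/ 4)%N = b -> (w %/ 4)%N = b ->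
    ~~ tadpole_edge 4 n v w ->
    a v * [:: c0; c1; c2; c3]`_(w %% 4)%N + a w * [:: c0; c1; c2; c3]`_(v %% 4)%N = 0.
  move=> vw vb wb; rewrite /tadpole_edge /= => nE; rewrite !AE.
  have := ltn_ord w; have := divn_eq v 4; have := divn_eq w 4.
  have := ltn_pmod v (isT : 0 < 4)%N; have := ltn_pmod w (isT : 0 < 4)%N.
  rewrite vb wb; move: (v %% 4)%N (w %% 4)%N => i i'.
  case: i => [|[|[|[|i]]]] //= _; case: i' => [|[|[|[|i']]]] //= _ ew ev ltw; try lia.
  - by rewrite /= ew ev [(b * 4)%N]mulnC addn0; apply: h02; lia.
  - by rewrite /= ew ev [(b * 4)%N]mulnC addn0; apply: h03; lia.
  - by rewrite /= ew ev [(b * 4)%N]mulnC; apply: h13; lia.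
move=> v w vw vb wb nE; case: (ltngtP v w) => [lt|lt|eq].
- exact: main.
- rewrite addrC; apply: main => //; move: nE; rewrite /tadpole_edge /=; lia.
- by move: vw; rewrite -val_eqE /= eq eqxx.
Qed.

(** If the form has coefficients a0, a1, a2, a3 on a block, then a0, a1, -a2, -a3 annihilate it; if
    a0 = a1 = 0, a single variable does. The first block only needs a0, 0, -a2, 0, or a single
    variable when a0 = 0. Keeping the representative [cs.2] off position 3 prevents adjacency
    between representatives of different blocks. *)
Let block4_form b : (4 * b < 4 + n)%N ->
  exists cs : seq k * 'I_(4 + n),
  [/\ (cs.2 %/ 4)%N = b, ((cs.2 %% 4)%N <= 2)%N, cs.1`_(cs.2 %% 4)%N != 0 &
    forall v w : 'I_(4 + n), v != w -> (v %/ 4)%N = b -> (w %/ 4)%N = b ->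
      ~~ tadpole_edge 4 n v w ->
      a v * cs.1`_(w %% 4)%N + a w * cs.1`_(v %% 4)%N = 0].
Proof.
move=> ltb.
have pos i : (i < 4)%N -> ((4 * b + i) %/ 4)%N = b /\ ((4 * b + i) %% 4)%N = i by lia.
suff [c0 [c1 [c2 [c3 [i [i2 ltbi ci [h02 h03 h13]]]]]]] : exists c0 c1 c2 c3 i,
    [/\ (i <= 2)%N, (4 * b + i < 4 + n)%N, [:: c0; c1; c2; c3]`_i != 0 &
      [/\ (4 * b + 2 < 4 + n)%N -> A (4 * b) * c2 + A (4 * b + 2) * c0 = 0,
        (4 * b + 3 < 4 + n)%N -> (0 < b)%N -> A (4 * b) * c3 + A (4 * b + 3) * c0 = 0 &
        (4 * b + 3 < 4 + n)%N -> A (4 * b + 1) * c3 + A (4 * b + 3) * c1 = 0]].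
  exists ([:: c0; c1; c2; c3], inord (4 * b + i)); rewrite /= inordK //.
  have [-> ->] := pos i (leq_ltn_trans i2 (isT : 2 < 4)%N).
  by split=> //; apply: block4_pairs.
case: (posnP b) => [b0|b0].
  case: (eqVneq (A 0) 0) => A0.
    exists 0, 0, 1, 0, 2%N; split; rewrite ?oner_neq0 //; first lia.
    by split=> *; rewrite ?b0 ?A0; ring.
  exists (A 0), 0, (- A 2), 0, 0%N; split=> //; first lia.
  by split=> *; rewrite ?b0 //= ?add0n; ring.
case: (eqVneq (A (4 * b)) 0) => Ap; last first.
  exists (A (4 * b)), (A (4 * b + 1)), (- A (4 * b + 2)), (- A (4 * b + 3)), 0%N.
  by split=> //; [lia|split=> *; ring].
case: (eqVneq (A (4 * b + 1)) 0) => Aq; last first.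
  exists (A (4 * b)), (A (4 * b + 1)), (- A (4 * b + 2)), (- A (4 * b + 3)), 1%N.
  by split=> //; [exact: A_neq0|split=> *; ring].
case: (ltnP (4 * b + 2) (4 + n)) => lt2.
  exists 0, 0, 1, 0, 2%N; split; rewrite ?oner_neq0 //.
  by split=> *; rewrite ?Ap ?Aq; ring.
exists 1, 0, 0, 0, 0%N; split; rewrite ?oner_neq0 //; first lia.
by split; lia.
Qed.

Lemma tadpole4_not_injective j : (n + 4 <= 4 * j < n + 8)%N ->
  ~ (forall f : {set 'I_(4 + n)} -> k,
      (forall S, indep (tadpole_edge 4 n) S -> #|S| = j.+1 -> up a f S = 0) ->
      forall S, indep (tadpole_edge 4 n) S -> #|S| = j -> f S = 0).
Proof.
case: j => [|j] hj; first lia.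
have /fin_all_exists [cs csP] : forall b : 'I_j.+1, exists cs : seq k * 'I_(4 + n),
    [/\ (cs.2 %/ 4)%N = b, ((cs.2 %% 4)%N <= 2)%N, cs.1`_(cs.2 %% 4)%N != 0 &
    forall v w : 'I_(4 + n), v != w -> (v %/ 4)%N = b -> (w %/ 4)%N = b ->
      ~~ tadpole_edge 4 n v w ->
      a v * cs.1`_(w %% 4)%N + a w * cs.1`_(v %% 4)%N = 0].
  by move=> b; apply: block4_form; have := ltn_ord b; lia.
pose blk (v : 'I_(4 + n)) : 'I_j.+1 := inord (v %/ 4)%N.
have blkE v : blk v = (v %/ 4)%N :> nat by rewrite /blk inordK //; have := ltn_ord v; lia.
have blk_s : cancel (fun b => (cs b).2) blk.
  by move=> b; apply: val_inj; rewrite /= blkE; case: (csP b).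
apply: (@up_not_injective _ _ _ _ _ (fun v => (cs (blk v)).1`_(v %% 4)%N) _ _ blk_s).
- by move=> b; rewrite blk_s; case: (csP b).
- move=> b b'; have [eb lb _ _] := csP b; have [eb' lb' _ _] := csP b'.
  move: (divn_eq (cs b).2 4) (divn_eq (cs b').2 4); rewrite eb eb' /tadpole_edge /=.
  case: (eqVneq b b') => [->|]; first lia.
  by rewrite -val_eqE /= => bb'; lia.
move=> v w vw bvw nE; rewrite -bvw.
by case: (csP (blk v)) => _ _ _; apply; rewrite -?blkE ?bvw.
Qed.

Lemma tadpole4_not_surjective j : (3 * j <= n + 1)%N ->
  ~ (forall g : {set 'I_(4 + n)} -> k, exists f : {set 'I_(4 + n)} -> k,
      forall S, indep (tadpole_edge 4 n) S -> #|S| = j.+1 -> up a f S = g S).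
Proof.
move=> hj.
(* The vector [(c1 b, c2 b)] is orthogonal to the coefficients of the form on the pair; the value 1
   keeps it nonzero when both of these vanish. Multiples of 3, hence both ends of the closing edge,
   get coefficient 0. *)
pose c1 b := if (A (3 * b + 1) == 0) && (A (3 * b + 2) == 0) then 1 else A (3 * b + 2).
pose c2 b := - A (3 * b + 1).
pose c (v : 'I_(4 + n)) := if ((v %/ 3)%N <= j)%N then
  [:: 0; c1 (v %/ 3)%N; c2 (v %/ 3)%N]`_(v %% 3)%N else 0.
pose s (b : 'I_j.+1) : 'I_(4 + n) := inord (3 * b + (if c1 b == 0%R then 2 else 1)).
(* Vertices beyond the last pair fall into block 0 by the default of [inord]; this is harmless
   because [c] vanishes on them. *)
pose blk (v : 'I_(4 + n)) : 'I_j.+1 := inord (v %/ 3)%N.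
have c_neq0 v : c v != 0 -> [/\ (v %/ 3 <= j)%N, (0 < v %% 3)%N & blk v = (v %/ 3)%N :> nat].
  rewrite /c /blk; case: ifP => [le|]; last by rewrite eqxx.
  by case: (v %% 3)%N => [|i]; rewrite ?eqxx // inordK.
have sE b : s b = (3 * b + (if c1 b == 0%R then 2 else 1))%N :> nat.
  by rewrite inordK //; have := ltn_ord b; case: ifP; lia.
have sb b : ((s b) %/ 3)%N = b by rewrite sE; case: ifP; lia.
have blk_s : cancel s blk.
  by move=> b; apply: val_inj; rewrite /= /blk sb inordK.
apply: (@up_not_surjective _ _ _ _ _ c _ _ blk_s).
- move=> b; rewrite /c sb leq_ord.
  have -> : (s b %% 3)%N = if c1 b == 0%R then 2 else 1 by rewrite sE; case: ifP; lia.
  case: ifPn => //=; rewrite /c1 /c2 oppr_eq0; case: ifP; rewrite ?oner_eq0 //.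
  by case: (A (3 * b + 1) == 0) => //= ->.
- move=> v w Evw /c_neq0[_ v3 bv] /c_neq0[_ w3 bw]; apply: val_inj; rewrite /= bv bw.
  by move: Evw; rewrite /tadpole_edge /=; lia.
- exact: tadpole_edge_irr.
move=> b; have ltb := ltn_ord b.
have [lt1 lt2] : (3 * b + 1 < 4 + n)%N /\ (3 * b + 2 < 4 + n)%N by lia.
have blkE (v : 'I_(4 + n)) : ((v %/ 3)%N = b) -> blk v = b.
  by move=> vb; apply: val_inj; rewrite /= /blk vb inordK.
rewrite (bigD1 (Ordinal lt1)) /=; last by rewrite blkE //=; lia.
rewrite (bigD1 (Ordinal lt2)) /=; last by rewrite blkE -?val_eqE //=; lia.
rewrite big1 => [|v /andP[/andP[/eqP bv]]]; last first.
  rewrite -!val_eqE /= => v1 v2; case: (eqVneq (c v) 0) => [->|/c_neq0[_ v3]].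
    by rewrite mulr0.
  by rewrite bv; lia.
rewrite addr0 !AE /c /=.
have -> : ((3 * b + 1) %/ 3)%N = b by lia.
have -> : ((3 * b + 2) %/ 3)%N = b by lia.
have -> : ((3 * b + 1) %% 3)%N = 1%N by lia.
have -> : ((3 * b + 2) %% 3)%N = 2%N by lia.
rewrite leq_ord /= /c1 /c2; case: ifP => [/andP[/eqP -> /eqP ->]|_]; ring.
Qed.

End Failure.

(** * Powers of the sum of the variables *)

Section UpOne.
Variables (k : fieldType) (N : nat).
Implicit Types (f g : {set 'I_N} -> k) (S T : {set 'I_N}).

Definition up1 f : {set 'I_N} -> k := fun S => \sum_(v in S) f (S :\ v).

Definition link v f : {set 'I_N} -> k := fun S => f (v |: S).

Lemma up1D f g S : up1 (fun T => f T + g T) S = up1 f S + up1 g S.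
Proof. exact: big_split. Qed.

Lemma up1B f g S : up1 (fun T => f T - g T) S = up1 f S - up1 g S.
Proof. exact: sumrB. Qed.

Lemma up1Z x f S : up1 (fun T => x * f T) S = x * up1 f S.
Proof. by rewrite /up1 mulr_sumr. Qed.

Lemma up1_eq f g S : (forall v, v \in S -> f (S :\ v) = g (S :\ v)) -> up1 f S = up1 g S.
Proof. exact: eq_bigr. Qed.
(** This locality allows identities known only on independent sets of one size to be substituted
    under an iterate. *)
Lemma iter_up1_eq p f g S :
  (forall T, T \subset S -> (#|T| + p = #|S|)%N -> f T = g T) ->
  iter p up1 f S = iter p up1 g S.
Proof.
elim: p S => [|p IH] S fg /=; first by apply: fg; rewrite ?addn0.
apply: eq_bigr => v vS; apply: IH => T sT cT; apply: fg.
  by apply: subset_trans sT (subsetDl _ _).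
by rewrite (cardsD1 v S) vS; lia.
Qed.

Lemma iter_up1_lin p x y f g S :
  iter p up1 (fun T => x * f T + y * g T) S
  = x * iter p up1 f S + y * iter p up1 g S.
Proof.
elim: p S => //= p IH S; rewrite /up1 !mulr_sumr -big_split /=.
by apply: eq_bigr.
Qed.

Lemma iter_up1_0 p f S :
  (forall T, T \subset S -> (#|T| + p = #|S|)%N -> f T = 0) -> iter p up1 f S = 0.
Proof.
move=> f0; rewrite (@iter_up1_eq p f (fun T => 0 * f T + 0 * f T)).
  by rewrite iter_up1_lin !mul0r addr0.
by move=> T sT cT; rewrite f0 // !mul0r addr0.
Qed.

Lemma iter_up1Z p x f S : iter p up1 (fun T => x * f T) S = x * iter p up1 f S.
Proof.
rewrite -[RHS]addr0 -[X in _ + X](mul0r (iter p up1 f S)) -iter_up1_lin.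
by apply: iter_up1_eq => T _ _; rewrite mul0r addr0.
Qed.

(* Leibniz rule: [up1] is multiplication by the sum of the variables, and [link v f]
   is the cofactor of the variable [v] in [f]. *)
Lemma iter_up1_link p v f S : v \notin S ->
  iter p up1 f (v |: S) = iter p up1 (link v f) S + p%:R * iter p.-1 up1 f S.
Proof.
elim: p S => [|p IH] S vS /=; first by rewrite mul0r addr0.
rewrite {1}/up1 big_setU1 //= setU1K //.
rewrite (eq_bigr (fun u => iter p up1 (link v f) (S :\ u)
                           + p%:R * iter p.-1 up1 f (S :\ u))).
  rewrite big_split /= -mulr_sumr -/(up1 (iter p up1 (link v f)) S).
  rewrite -/(up1 (iter p.-1 up1 f) S) addrCA; congr (_ + _).
  case: p {IH} => [|p] /=; first by rewrite mul0r addr0 mul1r.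
  by rewrite [in RHS]mulrS mulrDl mul1r.
move=> u uS; have uv : u != v by apply: contraNneq vS => <-.
have -> : (v |: S) :\ u = v |: (S :\ u).
  by apply/setP => w; rewrite !inE; case: (eqVneq w v) => [->|]; rewrite // eq_sym uv.
by rewrite IH // !inE negb_and vS orbT.
Qed.

Lemma up1_link v f S : v \notin S -> up1 f (v |: S) = f S + up1 (link v f) S.
Proof. by move=> vS; have := iter_up1_link 1 f vS; rewrite /= mul1r addrC. Qed.

End UpOne.

Arguments up1 {k N} f S.

(** * Injectivity and surjectivity of these powers on a path *)

Section Path.
Variables (k : fieldType) (n : nat).
Hypothesis chark0 : [pchar k] =i pred0.
Notation N := (4 + n)%N.
Notation G := (tadpole_edge 4 n).
Implicit Types (f g : {set 'I_N} -> k) (S T : {set 'I_N}).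

Let natr_neq0 p : p.+1%:R != 0 :> k.
Proof. by rewrite ((pcharf0P k).1 chark0). Qed.

(** For [4 <= m] these sets index the basis of the algebra of the final path segment from [m] on;
    vertex 4 is y_1, and past the last vertex only the empty set remains. *)
Definition tail m S := indep G S && [forall v in S, m <= v]%N.

Lemma tailP m S :
  reflect (indep G S /\ forall v, v \in S -> m <= v)%N (tail m S).
Proof. by apply: (iffP andP) => -[iS /forall_inP]. Qed.

Lemma tail_indep m S : tail m S -> indep G S. Proof. by case/andP. Qed.

Lemma tail_subset m S T : T \subset S -> tail m S -> tail m T.
Proof.
move=> sTS /tailP[iS mS]; apply/tailP; split; first exact: indepS iS.
by move=> v /(subsetP sTS)/mS.
Qed.

Lemma tail_leq m m' S : (m <= m')%N -> tail m' S -> tail m S.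
Proof.
move=> mm' /tailP[iS mS]; apply/tailP; split=> // v /mS; exact: leq_trans.
Qed.

Lemma tail_notin m (v : 'I_N) S : (v < m)%N -> tail m S -> v \notin S.
Proof. by move=> vm /tailP[_ mS]; apply/negP => /mS; lia. Qed.

Lemma tailU1 (v : 'I_N) S : (4 <= v)%N -> tail v.+2 S -> tail v (v |: S).
Proof.
move=> v4 /tailP[/indepP iS mS]; apply/tailP; split; last first.
  by move=> w; rewrite !inE => /orP[/eqP->|/mS]; lia.
apply/indepP => u w; rewrite !inE => /orP[/eqP->|uS] /orP[/eqP->|wS].
- by rewrite tadpole_edge_irr.
- by have := mS _ wS; rewrite /tadpole_edge /=; lia.
- by have := mS _ uS; rewrite /tadpole_edge /=; lia.
- exact: iS.
Qed.

Lemma tailD1 (v : 'I_N) S : (4 <= v)%N -> tail v S -> v \in S -> tail v.+2 (S :\ v).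
Proof.
move=> v4 tS vS; have /tailP[/indepP iS mS] := tS; apply/tailP; split.
  by apply: indepS (subsetDl _ _) (tail_indep tS).
move=> w; rewrite !inE -val_eqE /= => /andP[wv wS].
by have := iS _ _ vS wS; have := mS _ wS; rewrite /tadpole_edge /=; lia.
Qed.

Lemma tailS (v : 'I_N) S : tail v S -> v \notin S -> tail v.+1 S.
Proof.
move=> /tailP[iS mS] vS; apply/tailP; split=> // w wS.
by rewrite ltn_neqAle mS // andbT; apply: contraNneq vS => /val_inj->.
Qed.

(* The path [{v | m <= v}] has [N - m] vertices: the hypothesis is
   [4 j + 2 (p - 1) < N - m]. *)
Lemma path_inj p j m f : (4 <= m)%N -> (4 * j + 2 * p + m < N + 2)%N ->
  (forall S, tail m S -> #|S| = (j + p)%N -> iter p up1 f S = 0) ->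
  forall S, tail m S -> #|S| = j -> f S = 0.
Proof.
have [d] := ubnP (N + 2 - m); elim: d p j m f => // d IH p j m f ltd m4 hb f0.
case: p hb f0 => [|p] hb f0 S tS cS; first by apply: f0; rewrite ?addn0.
have ltm : (m < N)%N by lia.
have [v mv] : exists v : 'I_N, m = v by exists (Ordinal ltm).
subst m.
have addv T : tail v.+2 T -> v \notin T by apply: tail_notin => /=; lia.
(* Leibniz expresses the iterate [p.+1] of the cofactor of [v] through the iterate [p] of [f]; one
   more [up1] gives zero by [f0]. So the power rises to [p.+2] while the degree drops. *)
have f_v T : tail v.+2 T -> #|T|.+1 = j -> f (v |: T) = 0.
  case: j hb f0 cS => // j hb f0 cS tT [cT].
  apply: (IH p.+2 j v.+2 (link v f)) => //; try lia.
  move=> R tR cR; rewrite [LHS]/=; apply: etrans (_ : - p.+1%:R * up1 (iter p up1 f) R = 0).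
    rewrite /up1 mulr_sumr; apply: eq_bigr => u uR.
    have tRu : tail v.+2 (R :\ u) by apply: tail_subset tR; apply: subsetDl.
    have := iter_up1_link p.+1 f (addv _ tRu).
    rewrite f0; first by rewrite /= => /eqP; rewrite eq_sym addr_eq0 mulNr => /eqP.
      exact: tailU1.
    by rewrite cardsU1 addv //; move: cR; rewrite (cardsD1 u) uR; lia.
  have tmR : tail v R by apply: tail_leq tR; lia.
  have cjR : #|R| = (j.+1 + p.+1)%N by rewrite cR addSnnS.
  by have /= -> := f0 R tmR cjR; rewrite mulr0.
(* With the cofactor of [v] gone, Leibniz leaves [p.+1%:R] times the iterate [p] of [f], and
   characteristic zero permits division. *)
have f_2 T : tail v.+2 T -> #|T| = j -> f T = 0.
  apply: (IH p j v.+2 f); try lia; move=> R tR cR.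
  have := iter_up1_link p.+1 f (addv _ tR).
  rewrite f0; last 2 first.
  - exact: tailU1.
  - by rewrite cardsU1 addv //; lia.
  rewrite [X in X + _]iter_up1_0 => [|Q sQ cQ]; last first.
    by apply: f_v; [apply: tail_subset tR|lia].
  by move/eqP; rewrite add0r eq_sym mulf_eq0 (negPf (natr_neq0 _)) => /eqP.
(* For the next vertex the Leibniz remainder only involves sets settled by [f_2], so the power stays
   [p.+1]. *)
have f_w (w : 'I_N) T : w = v.+1 :> nat -> tail v.+3 T -> #|T|.+1 = j -> f (w |: T) = 0.
  case: j hb f0 cS f_v f_2 => // j hb f0 cS f_v f_2 wv tT [cT].
  apply: (IH p.+1 j v.+3 (link w f)) => //; try lia.
  move=> R tR cR; have wR : w \notin R by apply: tail_notin tR; lia.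
  have := iter_up1_link p.+1 f wR.
  rewrite f0; last 2 first.
  - by apply: (@tail_leq _ w); [lia|apply: tailU1; rewrite wv //; lia].
  - by rewrite cardsU1 wR; lia.
  rewrite [X in _ * X]iter_up1_0 ?mulr0 ?addr0 // => Q sQ cQ.
  by apply: f_2; [apply: (@tail_leq _ v.+3) => //; apply: tail_subset tR|lia].
case: (boolP (v \in S)) => vS.
  rewrite -(setD1K vS); apply: f_v; first exact: tailD1.
  by rewrite -cS (cardsD1 v S) vS.
have tS1 : tail v.+1 S := tailS tS vS.
case: (ltnP v.+1 N) => [ltw|geN]; last first.
  apply: f_2 => //; apply/tailP; split=> [|u /(proj2 (tailP _ _ tS1))].
    exact: tail_indep tS.
  by have := ltn_ord u; lia.
have [w wv] : exists w : 'I_N, w = v.+1 :> nat by exists (Ordinal ltw).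
rewrite -wv in tS1.
case: (boolP (w \in S)) => wS; last by apply: f_2 => //; rewrite -wv; apply: tailS.
rewrite -(setD1K wS); apply: f_w; rewrite -?wv //; first by apply: tailD1 => //; lia.
by rewrite -cS (cardsD1 w S) wS.
Qed.

(* The hypothesis is [N - m + 2 <= 3 i - (p - 1)]. *)
Lemma path_surj p i m g : (4 <= m <= N.+1)%N -> (N + 1 + p <= 3 * i + m)%N ->
  exists f, forall S, tail m S -> #|S| = i -> iter p up1 f S = g S.
Proof.
have [d] := ubnP (N + 2 - m); elim: d p i m g => // d IH p i m g ltd m4 hb.
case: p hb => [|p] hb; first by exists g.
(* Past the end the only tail is empty, while the hypothesis forces [0 < i]: the claim is
   vacuous. *)
case: (ltnP m N) => [ltm|geN]; last first.
  exists g => S /tailP[_ mS] cS.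
  have /eqP : #|S| == 0%N.
    by rewrite cards_eq0; apply/eqP/setP => u; rewrite inE; apply/negP => /mS;
      have := ltn_ord u; lia.
  by lia.
case: i hb => [|i] hb; first lia.
have [v mv] : exists v : 'I_N, m = v by exists (Ordinal ltm).
subst m.
have addv T : tail v.+2 T -> v \notin T by apply: tail_notin => /=; lia.
have notsub (R T : {set 'I_N}) : v \notin R -> T \subset R -> v \in T = false.
  by move=> vR sT; apply: contraNF vR; apply: (subsetP sT).
have [f1 ef1] : exists f1, forall S, tail v.+2 S -> #|S| = i ->
    iter p up1 f1 S = p.+1%:R^-1 * g (v |: S).
  by apply: (IH p i v.+2 (fun S => p.+1%:R^-1 * g (v |: S))); lia.
(* Free of the variable [v], this function solves the equation at the sets containing [v], by the
   second Leibniz term. *)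
pose f' T := if v \in T then 0 else f1 T.
have ef' S : tail v.+2 S -> #|S| = i -> iter p.+1 up1 f' (v |: S) = g (v |: S).
  move=> tS cS; rewrite iter_up1_link ?addv // [X in X + _]iter_up1_0 => [|T _ _].
    rewrite add0r /= (@iter_up1_eq _ _ _ _ f1) => [|T sT _].
      by rewrite ef1 // mulrA divff ?mul1r.
    by rewrite /f' (notsub S) ?addv.
  by rewrite /link /f' !inE eqxx.
have [h eh] : exists h, forall S, tail v.+1 S -> #|S| = i.+1 ->
    iter p.+2 up1 h S = g S - iter p.+1 up1 f' S.
  by apply: (IH p.+2 i.+1 v.+1 (fun S => g S - iter p.+1 up1 f' S)); lia.
(* This is [h] times the sum of the later variables minus [p.+1] times the variable [v]. The power
   [p.+1] then cancels at sets containing [v] and gives the iterate [p.+2] of [h] elsewhere, which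
   repairs the error of [f']. *)
pose f'' T := if v \in T then - p.+1%:R * h (T :\ v) else up1 h T.
exists (fun T => 1 * f' T + 1 * f'' T) => S tS cS.
rewrite iter_up1_lin !mul1r; case: (boolP (v \in S)) => vS; last first.
  rewrite [X in _ + X](@iter_up1_eq _ _ _ _ (up1 h)) => [|T sT _]; last first.
    by rewrite /f'' (notsub S).
  by rewrite -iterSr eh ?subrKC //; apply: (@tailS v).
have tSv : tail v.+2 (S :\ v) by apply: (@tailD1 v) => //=; lia.
have cSv : #|S :\ v| = i by move: cS; rewrite (cardsD1 v S) vS add1n => -[].
rewrite -(setD1K vS) ef' // iter_up1_link ?addv //.
rewrite (@iter_up1_eq _ _ _ (link v f'') (fun T => - p.+1%:R * h T)) => [|T sT _].
  rewrite iter_up1Z /= (@iter_up1_eq _ _ p f'' (up1 h)) => [|T sT _].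
    by rewrite -iterSr /= mulNr addNr addr0.
  by rewrite /f'' (notsub (S :\ v)) ?addv.
by rewrite /link /f'' !inE eqxx setU1K // (notsub (S :\ v)) ?addv.
Qed.
End Path.

(** * Eliminating the 4-cycle *)

Section Tadpole4.
Variables (k : fieldType) (n : nat).
Hypothesis chark0 : [pchar k] =i pred0.
Notation N := (4 + n)%N.
Notation G := (tadpole_edge 4 n).
Implicit Types (f g : {set 'I_N} -> k) (S T Y : {set 'I_N}).

Let v0 : 'I_N := inord 0.
Let v1 : 'I_N := inord 1.
Let v2 : 'I_N := inord 2.
Let v3 : 'I_N := inord 3.

Let val_v0 : v0 = 0%N :> nat. Proof. by rewrite inordK. Qed.
Let val_v1 : v1 = 1%N :> nat. Proof. by rewrite inordK. Qed.
Let val_v2 : v2 = 2%N :> nat. Proof. by rewrite inordK. Qed.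
Let val_v3 : v3 = 3%N :> nat. Proof. by rewrite inordK. Qed.
Let val_v := (val_v0, val_v1, val_v2, val_v3).

Let cycle_notin (v : 'I_N) Y : (v < 4)%N -> tail 4 Y -> v \notin Y.
Proof. exact: tail_notin. Qed.

Let tail54 Y : tail 5 Y -> tail 4 Y. Proof. exact: tail_leq. Qed.

Let tailD m Y v : tail m Y -> tail m (Y :\ v).
Proof. by apply: tail_subset; apply: subsetDl. Qed.

Let neq_v (u v : 'I_N) : u <> v :> nat -> (u == v) = false.
Proof. by move=> uv; apply/negbTE; rewrite -val_eqE; apply/eqP. Qed.

Let indepU1 (v : 'I_N) S : indep G S -> (forall w, w \in S -> ~~ G v w) -> indep G (v |: S).
Proof.
move=> /indepP iS nE; apply/indepP => u w; rewrite !inE.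
move=> /orP[/eqP->|uS] /orP[/eqP->|wS]; rewrite ?tadpole_edge_irr //.
- exact: nE.
- by have := nE _ uS; rewrite /tadpole_edge /=; lia.
- exact: iS.
Qed.

Let indep_cycle (v : 'I_N) Y : (v < 3)%N -> tail 4 Y -> indep G (v |: Y).
Proof.
move=> lv /tailP[iY mY]; apply: indepU1 => // w /mY; rewrite /tadpole_edge /=; lia.
Qed.

Let indep_v3 Y : tail 5 Y -> indep G (v3 |: Y).
Proof.
move=> /tailP[iY mY]; apply: indepU1 => // w /mY.
by rewrite /tadpole_edge /= !val_v; lia.
Qed.

Let indep_v02 Y : tail 4 Y -> indep G (v2 |: (v0 |: Y)).
Proof.
move=> tY; apply: indepU1 => [|w]; first by apply: indep_cycle; rewrite ?val_v.
rewrite !inE => /orP[/eqP->|]; first by rewrite /tadpole_edge /= !val_v.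
by move: tY => /tailP[_ mY] /mY; rewrite /tadpole_edge /= !val_v; lia.
Qed.

Let indep_v13 Y : tail 5 Y -> indep G (v3 |: (v1 |: Y)).
Proof.
move=> tY; apply: indepU1 => [|w].
  by apply: indep_cycle (tail54 tY); rewrite val_v.
rewrite !inE => /orP[/eqP->|]; first by rewrite /tadpole_edge /= !val_v.
by move: tY => /tailP[_ mY] /mY; rewrite /tadpole_edge /= !val_v; lia.
Qed.

(** An independent set meets the cycle in nothing, one vertex or a diagonal; [v3] is joined to
    vertex 4, whence [tail 5] when it is present. *)
Let indep_tadpole4_ind (P : {set 'I_N} -> Prop) :
  (forall Y, tail 4 Y -> P Y) ->
  (forall Y, tail 4 Y -> P (v0 |: Y)) -> (forall Y, tail 4 Y -> P (v1 |: Y)) ->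
  (forall Y, tail 4 Y -> P (v2 |: Y)) -> (forall Y, tail 5 Y -> P (v3 |: Y)) ->
  (forall Y, tail 4 Y -> P (v2 |: (v0 |: Y))) ->
  (forall Y, tail 5 Y -> P (v3 |: (v1 |: Y))) ->
  forall S, indep G S -> P S.
Proof.
move=> P_ P0 P1 P2 P3 P02 P13 S iS; have /indepP E := iS.
have tail4 T : T \subset S -> v0 \notin T -> v1 \notin T -> v2 \notin T -> v3 \notin T ->
    tail 4 T.
  move=> sT n0 n1 n2 n3; apply/tailP; split; first exact: indepS iS.
  move=> w wT; have neq (v : 'I_N) : v \notin T -> w != v by apply: contraNneq => <-.
  have := neq _ n0; have := neq _ n1; have := neq _ n2; have := neq _ n3.
  by rewrite -!val_eqE /= !val_v; lia.
have tail5 T : T \subset S -> v3 \in S -> tail 4 T -> tail 5 T.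
  move=> sT S3 /tailP[iT mT]; apply/tailP; split=> // w wT.
  have := E _ _ S3 (subsetP sT _ wT); have := mT w wT.
  by rewrite /tadpole_edge /= !val_v; lia.
have excl (u v : 'I_N) : u \in S -> G u v -> v \notin S.
  by move=> uS; apply: contraL; apply: E.
have sub1 u : S :\ u \subset S by apply: subsetDl.
have sub2 u v : S :\ u :\ v \subset S by rewrite setDDl subsetDl.
have nD (u v : 'I_N) : v \notin S -> v \notin S :\ u.
  by move=> vS; rewrite !inE negb_and vS orbT.
have nD1 (u : 'I_N) T : u \notin T :\ u by rewrite !inE eqxx.
case: (boolP (v0 \in S)) => S0.
  have S1 : v1 \notin S by apply: excl S0 _; rewrite /tadpole_edge /= !val_v.
  have S3 : v3 \notin S by apply: excl S0 _; rewrite /tadpole_edge /= !val_v.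
  case: (boolP (v2 \in S)) => S2.
    rewrite -(setD1K S2) -(@setD1K _ v0 (S :\ v2)); last first.
      by rewrite !inE neq_v ?S0 // !val_v.
    apply: P02; apply: tail4; rewrite ?sub2 ?nD1 //;
      by rewrite !inE ?(negPf S1) ?(negPf S3) ?eqxx ?andbF.
  by rewrite -(setD1K S0); apply: P0; apply: tail4; rewrite ?nD1 // nD.
case: (boolP (v1 \in S)) => S1.
  have S2 : v2 \notin S by apply: excl S1 _; rewrite /tadpole_edge /= !val_v.
  case: (boolP (v3 \in S)) => S3.
    rewrite -(setD1K S3) -(@setD1K _ v1 (S :\ v3)); last first.
      by rewrite !inE neq_v ?S1 // !val_v.
    apply: P13; apply: tail5; rewrite ?sub2 //; apply: tail4; rewrite ?sub2 ?nD1 //;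
      by rewrite !inE ?(negPf S0) ?(negPf S2) ?eqxx ?andbF.
  by rewrite -(setD1K S1); apply: P1; apply: tail4; rewrite ?nD1 // nD.
case: (boolP (v2 \in S)) => S2.
  have S3 : v3 \notin S by apply: excl S2 _; rewrite /tadpole_edge /= !val_v.
  by rewrite -(setD1K S2); apply: P2; apply: tail4; rewrite ?nD1 // nD.
case: (boolP (v3 \in S)) => S3; last by apply: P_; apply: tail4.
rewrite -(setD1K S3); apply: P3; apply: tail5 => //.
by apply: tail4; rewrite ?nD1 // nD.
Qed.

Let two_neq0 : 2%:R != 0 :> k.
Proof. by rewrite ((pcharf0P k).1 chark0). Qed.

(** The cofactors of [v0], [v1], [v2] agree by the first power on the path. The diagonals then
    vanish, [h] by the third power and [h'] by the second, and everything else follows. The bound on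
    [j] is exactly what [path_inj] requires for the first and third powers. *)
Lemma tadpole4_injective j f : (4 * j < N)%N ->
  (forall S, indep G S -> #|S| = j.+1 -> up1 f S = 0) ->
  forall S, indep G S -> #|S| = j -> f S = 0.
Proof.
move=> hj f0.
have card (v : 'I_N) Y : (v < 4)%N -> tail 4 Y -> #|v |: Y| = #|Y|.+1.
  by move=> lv tY; rewrite cardsU1 cycle_notin.
have e_cycle (v : 'I_N) Y : (v < 3)%N -> tail 4 Y -> #|Y| = j -> f Y + up1 (link v f) Y = 0.
  move=> lv tY cY; have lv4 : (v < 4)%N by lia.
  rewrite -up1_link ?cycle_notin //; apply: f0; first exact: indep_cycle.
  by rewrite card // cY.
have e_v3 Y : tail 5 Y -> #|Y| = j -> f Y + up1 (link v3 f) Y = 0.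
  move=> tY cY; rewrite -up1_link ?cycle_notin ?val_v //; last exact: tail54.
  by apply: f0; [exact: indep_v3|rewrite card ?cY ?val_v //; exact: tail54].
have e_pair (u v : 'I_N) Y : (u < 4)%N -> (v < 4)%N -> u != v -> tail 4 Y ->
    indep G (v |: (u |: Y)) -> #|Y|.+1 = j ->
    f (u |: Y) + (f (v |: Y) + up1 (fun T => f (v |: (u |: T))) Y) = 0.
  move=> lu lv uv tY iY cY; have vY : v \notin u |: Y.
    by rewrite !inE negb_or eq_sym uv cycle_notin.
  have uY := cycle_notin lu tY.
  rewrite -[X in _ + (_ + X)]/(up1 (link u (link v f)) Y).
  rewrite -[f (v |: Y)]/(link v f Y) -up1_link // -up1_link //.
  by apply: f0 => //; rewrite cardsU1 vY card // cY.
have eq_cycle (u v : 'I_N) Y : (u < 3)%N -> (v < 3)%N -> tail 4 Y -> #|Y|.+1 = j ->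
    f (u |: Y) = f (v |: Y).
  move=> lu lv; case: j hj f0 e_cycle {card e_v3 e_pair} => // j hj f0 e_cycle tY [cY].
  apply/eqP; rewrite -subr_eq0; apply/eqP.
  apply: (@path_inj _ _ chark0 1 j 4 (fun T => link u f T - link v f T) _ _ _ _ tY cY).
  - by [].
  - by lia.
  move=> S tS; rewrite addn1 => cS; rewrite /= up1B.
  by rewrite -(subrr 0) -{1}(e_cycle u S) // -(e_cycle v S) //; ring.
pose h Y := f (v2 |: (v0 |: Y)).
have e_h Y : tail 4 Y -> #|Y|.+1 = j -> 2%:R * f (v0 |: Y) + up1 h Y = 0.
  move=> tY cY; rewrite -[RHS](e_pair v0 v2 Y) ?val_v ?neq_v ?val_v //; last exact: indep_v02.
  by rewrite (eq_cycle v2 v0) ?val_v // addrA mulr_natl mulr2n.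
(* With l the sum of the path variables and f_0 the cofactor of [v0]: l^3 h = -2 l^2 f_0 = 2 l f =
   0. *)
have h0 Y : tail 4 Y -> #|Y|.+2 = j -> h Y = 0.
  case: j hj f0 e_cycle e_h {card e_v3 e_pair eq_cycle}
    => // -[|j] // hj f0 e_cycle e_h tY [cY].
  apply: (@path_inj _ _ chark0 3 j 4 h _ _ _ _ tY cY); [by []|by lia|].
  move=> S tS; rewrite addn3 => cS.
  have -> : iter 3 up1 h S = iter 2 up1 (fun T => - 2%:R * link v0 f T) S.
    rewrite iterSr; apply: iter_up1_eq => T sT cT.
    have cT' : #|T|.+1 = j.+2 by lia.
    have /eqP := e_h T (tail_subset sT tS) cT'.
    by rewrite addrC addr_eq0 mulNr => /eqP.
  rewrite iter_up1Z iterSr (@iter_up1_eq _ _ _ _ (fun T => - 1 * f T)) => [|T sT cT].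
    by rewrite iter_up1Z /= f0 ?mulr0 //; apply: tail_indep tS.
  have lt0 : (v0 < 3)%N by rewrite val_v.
  have cT' : #|T| = j.+2 by lia.
  have /eqP := e_cycle v0 T lt0 (tail_subset sT tS) cT'.
  by rewrite addrC addr_eq0 mulN1r => /eqP.
have f_v0 Y : tail 4 Y -> #|Y|.+1 = j -> f (v0 |: Y) = 0.
  move=> tY cY; have := e_h Y tY cY; rewrite [X in _ + X](@iter_up1_0 _ _ 1) => [|T sT cT].
    by move/eqP; rewrite addr0 mulf_eq0 (negPf two_neq0) => /eqP.
  by apply: h0; [apply: tail_subset tY|lia].
have f_tail Y : tail 4 Y -> #|Y| = j -> f Y = 0.
  move=> tY cY; have := e_cycle v0 Y; rewrite val_v => /(_ isT tY cY).
  rewrite [X in _ + X](@iter_up1_0 _ _ 1) ?addr0 // => T sT cT.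
  by apply: f_v0; [apply: tail_subset tY|lia].
pose h' Y := f (v3 |: (v1 |: Y)).
have e_h' Y : tail 5 Y -> #|Y|.+1 = j -> f (v3 |: Y) + up1 h' Y = 0.
  move=> tY cY; have tY4 := tail54 tY.
  rewrite -[RHS](e_pair v1 v3 Y) ?val_v ?neq_v ?val_v //; last exact: indep_v13.
  by rewrite (eq_cycle v1 v0) ?val_v // f_v0 // add0r.
(* With f_3 the cofactor of [v3]: l^2 h' = - l f_3 = f = 0 on the path from vertex 5. *)
have h'0 Y : tail 5 Y -> #|Y|.+2 = j -> h' Y = 0.
  case: j hj f_tail e_v3 e_h' {f0 card e_cycle e_h eq_cycle h0 f_v0 e_pair}
    => // -[|j] // hj f_tail e_v3 e_h' tY [cY].
  apply: (@path_inj _ _ chark0 2 j 5 h' _ _ _ _ tY cY); [by []|by lia|].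
  move=> S tS; rewrite addn2 => cS; rewrite /=.
  rewrite (@up1_eq _ _ _ (fun T => - 1 * link v3 f T)) => [|v vS].
    have := e_v3 S tS cS; rewrite f_tail // ?add0r; last exact: tail54.
    by rewrite up1Z => ->; rewrite mulr0.
  have cSv : #|S :\ v|.+1 = j.+2 by rewrite -cS (cardsD1 v S) vS.
  have /eqP := e_h' _ (tailD v tS) cSv; rewrite addrC addr_eq0 mulN1r => /eqP.
  exact.
have f_v3 Y : tail 5 Y -> #|Y|.+1 = j -> f (v3 |: Y) = 0.
  move=> tY cY; have := e_h' Y tY cY; rewrite [X in _ + X](@iter_up1_0 _ _ 1) ?addr0 //.
  by move=> T sT cT; apply: h'0; [apply: tail_subset tY|lia].
apply: indep_tadpole4_ind => Y tY cY.
- exact: f_tail.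
- by apply: f_v0; rewrite // -(card v0) ?val_v.
- by rewrite (eq_cycle v1 v0) ?val_v ?f_v0 //; rewrite -(card v1) ?val_v.
- by rewrite (eq_cycle v2 v0) ?val_v ?f_v0 //; rewrite -(card v2) ?val_v.
- by apply: f_v3; rewrite // -(card v3) ?val_v //; apply: tail54.
- apply: h0 => //; rewrite -cY cardsU1 card ?val_v // !inE neq_v ?val_v //.
  by rewrite (negPf (cycle_notin _ tY)) ?val_v.
- have tY4 := tail54 tY; apply: h'0 => //.
  rewrite -cY cardsU1 card ?val_v // !inE neq_v ?val_v //.
  by rewrite (negPf (cycle_notin _ tY4)) ?val_v.
Qed.

(** Sorting sets by their trace on the cycle gives seven equations in seven functions on the path,
    solved in the order [f13], [f0], [f1] and [f2], [f24], [f3] and [f4]. *)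
Lemma tadpole4_surjective j g : (N <= 3 * j + 2)%N ->
  exists f, forall S, indep G S -> #|S| = j.+1 -> up1 f S = g S.
Proof.
move=> hj.
(* Indices follow x_1 to x_4: [g1] belongs to [v0], and [g13] to the diagonal [v0], [v2]. *)
pose g1 := link v0 g; pose g2 := link v1 g; pose g3 := link v2 g; pose g4 := link v3 g.
pose g13 Y := g (v2 |: (v0 |: Y)); pose g24 Y := g (v3 |: (v1 |: Y)).
(* From f0 + l f1 = g1, f0 + l f3 = g3 and f1 + f3 + l f13 = g13 follows 2 f0 = g1 + g3 - l g13 +
   l^2 f13; then l f0 = g prescribes l^3 f13. *)
have [f13 e13] := @path_surj _ n chark0 3 j.+1 4
  (fun Y => 2%:R * g Y - up1 (fun T => g1 T + g3 T - up1 g13 T) Y) isT ltac:(lia).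
pose f0 Y := 2%:R^-1 * ((g1 Y + g3 Y - up1 g13 Y) + up1 (up1 f13) Y).
have [f1 e1] := @path_surj _ n chark0 1 j 4 (fun Y => g1 Y - f0 Y) isT ltac:(lia).
have [f2 e2] := @path_surj _ n chark0 1 j 4 (fun Y => g2 Y - f0 Y) isT ltac:(lia).
(* Substituting f4 = g24 - f2 - l f24 into f0 + l f4 = g4 prescribes l^2 f24, only on [tail 5]
   because [v3] is present. *)
have [f24 e24] := @path_surj _ n chark0 2 j 5
  (fun Y => f0 Y + up1 g24 Y - up1 f2 Y - g4 Y) ltac:(lia) ltac:(lia).
pose f3 Y := g13 Y - f1 Y - up1 f13 Y.
pose f4 Y := g24 Y - f2 Y - up1 f24 Y.
pose core S := [set w in S | 4 <= w]%N.
pose f S := (if v0 \in S then if v2 \in S then f13 else f1 else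
             if v2 \in S then f3 else
             if v1 \in S then if v3 \in S then f24 else f2 else
             if v3 \in S then f4 else f0) (core S).
have coreE Y : tail 4 Y -> core Y = Y.
  move=> /tailP[_ mY]; apply/setP => w; rewrite !inE; case: (boolP (w \in Y)) => // /mY ->.
  by [].
have coreU (v : 'I_N) S : (v < 4)%N -> core (v |: S) = core S.
  move=> lv; apply/setP => w; rewrite !inE; case: (eqVneq w v) => [->|_] //=.
  by rewrite leqNgt lv andbF.
have notY (v : 'I_N) Y : (v < 4)%N -> tail 4 Y -> (v \in Y) = false.
  by move=> lv tY; apply/negbTE/cycle_notin.
have vE : ((v0 == v1) = false) * ((v0 == v2) = false) * ((v0 == v3) = false) *
   ((v1 == v2) = false) * ((v1 == v3) = false) * ((v2 == v3) = false) *
   ((v1 == v0) = false) * ((v2 == v0) = false) * ((v3 == v0) = false) *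
   ((v2 == v1) = false) * ((v3 == v1) = false) * ((v3 == v2) = false).
  by do ![split]; rewrite neq_v // !val_v.
have lt4 : (v0 < 4)%N * (v1 < 4)%N * (v2 < 4)%N * (v3 < 4)%N by rewrite !val_v.
have fE Y : tail 4 Y -> [/\ f Y = f0 Y, f (v0 |: Y) = f1 Y, f (v1 |: Y) = f2 Y,
    f (v2 |: Y) = f3 Y & f (v3 |: Y) = f4 Y] /\
    (f (v2 |: (v0 |: Y)) = f13 Y /\ f (v3 |: (v1 |: Y)) = f24 Y).
  move=> tY; rewrite /f !coreU ?lt4 // coreE //.
  by rewrite !inE !eqxx !vE !notY ?lt4.
have linkE (v : 'I_N) (f' : {set 'I_N} -> k) Y : (v < 4)%N -> tail 4 Y ->
    (forall T, tail 4 T -> f (v |: T) = f' T) -> up1 f (v |: Y) = f0 Y + up1 f' Y.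
  move=> lv tY ff'; rewrite up1_link ?cycle_notin //.
  have [[-> _ _ _ _] _] := fE Y tY; congr (_ + _).
  by apply: up1_eq => u uY; apply: ff'; apply: tailD.
have pairE (u v : 'I_N) (fu fv fuv : {set 'I_N} -> k) Y :
    (u < 4)%N -> (v < 4)%N -> u != v -> tail 4 Y ->
    (forall T, tail 4 T -> f (u |: T) = fu T) -> (forall T, tail 4 T -> f (v |: T) = fv T) ->
    (forall T, tail 4 T -> f (v |: (u |: T)) = fuv T) ->
    up1 f (v |: (u |: Y)) = fu Y + (fv Y + up1 fuv Y).
  move=> lu lv uv tY hu hv huv; rewrite up1_link; last first.
    by rewrite !inE negb_or eq_sym uv cycle_notin.
  rewrite up1_link ?cycle_notin // hu // /link hv //; congr (_ + (_ + _)).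
  by apply: up1_eq => w wY; apply: huv; apply: tailD.
have card (v : 'I_N) Y : (v < 4)%N -> tail 4 Y -> #|v |: Y| = j.+1 -> #|Y| = j.
  by move=> lv tY; rewrite cardsU1 cycle_notin // => -[].
exists f; apply: indep_tadpole4_ind => Y tY cY.
- rewrite (@up1_eq _ _ _ f0) => [|v vY]; last by have [[]] := fE _ (tailD v tY).
  rewrite /f0 up1Z up1D -[X in _ + X]/(iter 3 up1 f13 Y) e13 //.
  by rewrite addrC subrK mulrA mulVf ?mul1r.
- rewrite (linkE v0 f1) ?lt4 // => [|T /fE[[]] //].
  by have /= -> := e1 Y tY (card _ _ lt4.1.1.1 tY cY); rewrite addrC subrK.
- rewrite (linkE v1 f2) ?lt4 // => [|T /fE[[]] //].
  by have /= -> := e2 Y tY (card _ _ lt4.1.1.2 tY cY); rewrite addrC subrK.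
- rewrite (linkE v2 f3) ?lt4 // => [|T /fE[[]] //].
  rewrite /f3 !up1B; have /= -> := e1 Y tY (card _ _ lt4.1.2 tY cY).
  have f0E : 2%:R * f0 Y = g1 Y + g3 Y - up1 g13 Y + up1 (up1 f13) Y.
    by rewrite /f0 mulrA divff ?mul1r.
  rewrite -[g _]/(g3 Y).
  transitivity (2%:R * f0 Y + up1 g13 Y - g1 Y - up1 (up1 f13) Y); first by ring.
  by rewrite f0E; ring.
- have tY4 := tail54 tY.
  rewrite (linkE v3 f4) ?lt4 // => [|T /fE[[]] //].
  rewrite /f4 !up1B; have /= -> := e24 Y tY (card _ _ lt4.2 tY4 cY).
  by rewrite -[g (v3 |: Y)]/(g4 Y); ring.
- rewrite (pairE v0 v2 f1 f3 f13) ?vE ?lt4 //; try by move=> T /fE[[] ? ? ? ? ? []].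
  by rewrite /f3 -[g _]/(g13 Y); ring.
- have tY4 := tail54 tY.
  rewrite (pairE v1 v3 f2 f4 f24) ?vE ?lt4 //; try by move=> T /fE[[] ? ? ? ? ? []].
  by rewrite /f4 -[g _]/(g24 Y); ring.
Qed.

End Tadpole4.

(** * Comparison of the bounds for each [n] *)

Theorem theorem4p3 (k : fieldType) (chark0 : [pchar k]%R =i pred0) (n : nat)
  (hn : (1 <= n)%N) :
  WLP k (tadpole_edge 4 n) <-> n \in [:: 1; 2; 3; 4; 5; 6; 7; 9; 10; 13]%N.
Proof.
have E_irr : irreflexive (tadpole_edge 4 n) by apply: tadpole_edge_irr.
split=> [[l l1 wlp]|].
  (* This [j] is the ceiling of (n+4)/4, the number of blocks of four; for [n] outside the list it
     also satisfies [3 * j <= n + 1]. *)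
  apply: contraT; rewrite !inE => n_notin; pose j := ((n + 7) %/ 4)%N.
  case: (wlp j) => [/(mult_injectiveP E_irr j l1)|/(mult_surjectiveP E_irr j l1)].
    by move/tadpole4_not_injective => []; rewrite /j; lia.
  by move/tadpole4_not_surjective => []; rewrite /j; lia.
rewrite !inE => n_in.
pose l : {mpoly k[4 + n]} := \sum_v 'X_v.
have l1 : l \is 1.-homog by apply: rpred_sum => v _; rewrite dhomogX /= mdeg1.
have upE f S : up (fun v => l@_U_(v)) f S = up1 f S.
  apply: eq_bigr => v _; rewrite raddf_sum /= (bigD1 v) //= mcoeffXU eqxx.
  rewrite big1 ?addr0 ?mul1r //.
  by move=> w /negPf wv; rewrite mcoeffXU wv.
(* For the listed [n], [3 * j <= n + 1] implies [4 * j < n + 4], so no degree escapes both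
   criteria. *)
exists l => // j; case: (leqP (4 + n) (3 * j + 2)) => hj; [right|left].
  apply/(mult_surjectiveP E_irr j l1) => g.
  have [f ef] := tadpole4_surjective chark0 g hj.
  by exists f => S iS cS; rewrite upE ef.
apply/(mult_injectiveP E_irr j l1) => f f0; apply: (tadpole4_injective chark0); first lia.
by move=> S iS cS; rewrite -upE f0.
Qed.
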